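(* Let $T_0$ be any initial BST. For every $\epsilon>0$ there exist a query sequence $X$ and a (not necessarily consecutive) subsequence $X'$ of $X$ such that $$\mathrm{cost}(GF,X',T_0)\ge(2-\epsilon)\cdot\mathrm{cost}(GF,X,T_0).$$
   Context: Binary search tree model. Keys are $\{1,\dots,n\}$. A query sequence is $X=[x_1,\dots,x_m]\in[n]^m$ and $T_0$ is an initial binary search tree (BST) on the keys. An algorithm $A$ serves $x_1,\dots,x_m$ in order. Before serving $x_t$ it holds a BST $T_{t-1}$; it searches $x_t$ from the root and may then restructure the tree by rotations into $T_t$. Let $P_t$ be the set of nodes on the root-to-$x_t$ path of $T_{t-1}$, and let $U_t$ be the node set of the minimal subtree containing all edges rotated in transforming $T_{t-1}$ into $T_t$. The cost at time $t$ is $|P_t\cup U_t|$, and $\mathrm{cost}(A,X,T_0)$ is the sum of these costs over $t=1,\dots,m$. Greedy Future ($GF$). After finding $x_t$ in $T_{t-1}$, let $v_1<\dots<v_k$ be the keys on the root-to-$x_t$ path, set $v_0=-\infty$ and $v_{k+1}=+\infty$, and let $R_0,\dots,R_k$ be the subtrees hanging off this path. For each $i$, $\tau(v_i)$ is the smallest $s>t$ with $x_s\in(v_{i-1},v_{i+1})$, or $+\infty$ if there is none. $GF$ rearranges $v_1,\dots,v_k$ as a treap: a BST in key order and a heap in $\tau$, with the smallest $\tau$ at the top. Ties in $\tau$ are broken in favor of the node of smaller depth in $T_{t-1}$. It then reattaches $R_0,\dots,R_k$ unchanged at their unique positions, giving $T_t$.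
   Formalization: The initial BST is required to have at least N(ε) keys and X to be nonempty: with one key every search costs 1, so the claim fails for nonempty X when ε < 1, while an empty X would make it trivial. *)

(* Defs.v *)
From mathcomp Require Import all_boot.
From Stdlib Require Import Reals.

Set Implicit Arguments.
Unset Strict Implicit.
Unset Printing Implicit Defensive.

Inductive bst : Type :=
| Leaf : bst
| Node : bst -> nat -> bst -> bst.

Fixpoint inorder (t : bst) : seq nat :=
  match t with
  | Leaf => [::]
  | Node l k r => inorder l ++ k :: inorder r
  end.

Definition is_bst_on (n : nat) (t : bst) : bool := inorder t == iota 1 n.

Definition in_keys (n : nat) (x : nat) : bool := (1 <= x) && (x <= n).

(* Search for x from the root.  Returns
   - the nodes of the root-to-x path, in increasing key order, each paired
     with its depth in t (root has depth d = 0 in the top call), and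
   - the subtrees R_0, ..., R_k hanging off that path, in key order. *)
Fixpoint decomp (t : bst) (x d : nat) : seq (nat * nat) * seq bst :=
  match t with
  | Leaf => ([::], [:: Leaf])
  | Node l k r =>
      if x == k then ([:: (k, d)], [:: l; r])
      else if x < k then
        let: (ps, rs) := decomp l x d.+1 in (rcons ps (k, d), rcons rs r)
      else
        let: (ps, rs) := decomp r x d.+1 in ((k, d) :: ps, l :: rs)
  end.

Definition search_path (t : bst) (x : nat) : seq (nat * nat) := (decomp t x 0).1.

Definition in_gap (lo hi : option nat) (y : nat) : bool :=
  (if lo is Some a then a < y else true) && (if hi is Some b then y < b else true).

(* Next occurrence (position in the future sequence [x_{t+1}, ..., x_m]) of a
   query in (lo, hi); None = +oo.  Position j corresponds to time s = t+1+j,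
   an order-preserving shift, so comparisons of tau are unaffected. *)
Definition next_in (fut : seq nat) (lo hi : option nat) : option nat :=
  let j := find (in_gap lo hi) fut in
  if j < size fut then Some j else None.

Definition tau (ks : seq nat) (fut : seq nat) (i : nat) : option nat :=
  let lo := if i is i'.+1 then Some (nth 0 ks i') else None in
  let hi := if i.+1 < size ks then Some (nth 0 ks i.+1) else None in
  next_in fut lo hi.

(* Priority (tau, depth): smaller tau first (None = +oo), ties broken by
   smaller depth in T_{t-1}. *)
Definition prio_lt (a b : option nat * nat) : bool :=
  match a.1, b.1 with
  | Some x, Some y => (x < y) || ((x == y) && (a.2 < b.2))
  | Some _, None => true
  | None, Some _ => false
  | None, None => a.2 < b.2
  end.

Fixpoint minidx (s : seq (nat * (option nat * nat))) : nat :=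
  match s with
  | [::] => 0
  | x :: s' =>
      if s' is [::] then 0
      else let j := minidx s' in
           if prio_lt (nth x s' j).2 x.2 then j.+1 else 0
  end.

(* Treap on keys vs (sorted, with priorities) with the subtrees rs
   (size rs = size vs + 1) reattached in their unique positions. *)
Fixpoint build (fuel : nat) (vs : seq (nat * (option nat * nat))) (rs : seq bst)
  : bst :=
  match fuel with
  | 0 => head Leaf rs
  | f.+1 =>
      if vs is [::] then head Leaf rs
      else
        let i := minidx vs in
        Node (build f (take i vs) (take i.+1 rs))
             (nth 0 (map fst vs) i)
             (build f (drop i.+1 vs) (drop i.+1 rs))
  end.

Definition gf_step (t : bst) (x : nat) (fut : seq nat) : bst :=
  let: (ps, rs) := decomp t x 0 in
  let ks := map fst ps in
  let pr := [seq (tau ks fut i, (nth (0, 0) ps i).2) | i <- iota 0 (size ps)] in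
  build (size ps) (zip ks pr) rs.

(* Total cost of GF on X from T0.  The cost of a step is |P_t u U_t|;
   GF only rotates edges among the nodes of the search path P_t, so
   U_t is contained in P_t and the step cost is |P_t|. *)
Fixpoint gf_cost (t : bst) (X : seq nat) : nat :=
  match X with
  | [::] => 0
  | x :: X' => size (search_path t x) + gf_cost (gf_step t x X') X'
  end.

(* Main.v *)
(** The set of nodes on the search path of a query [x] under Greedy Future
    does not depend on the future: if [rho y] is the last time [y] was touched
    (with [T0] read as a heap for the initial values), the path consists of the
    [y] such that every key from [x] to [y] other than [y] was last touched
    strictly before [y].

    In this picture GF can get stuck in two different regimes on one and the
    same query sequence.  Take a recursive block made of a left block, three
    keys [a < c < b] and a right block, and query at every level cyclically: the
    centre [c], the right block, the left block.  If [a] and [b] are older than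
    all queried keys they are never touched, and the centres behave like a static
    tree: each level costs 1, 1, 1 in a round.  If [a] and [b] are newer than
    the rest, they take over the role of [c] and each level costs 3, 1, 2.
    Only the leaves, a fraction [(2/3)^d] of the queries, cost the same in
    both regimes.  The expensive regime is reached by a finite prefix; the
    cheap one by inserting after it queries that make all keys but the smallest
    tie. *)

Require Import Defs.
From mathcomp Require Import all_boot zify.
From Stdlib Require Import Reals Lra.
(* [Reals] rebinds [^] on [nat] to [Nat.pow]. *)
Import ssrnat.

Set Implicit Arguments.
Unset Strict Implicit.
Unset Printing Implicit Defensive.

(** * Greedy Future in terms of last-touch times *)

Definition touch (rho : nat -> nat) (x y : nat) : bool :=
  all (fun z => (z == y) || (rho z < rho y))
      (iota (minn x y) (maxn x y - minn x y).+1).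

Lemma touchP rho x y :
  reflect (forall z, minn x y <= z <= maxn x y -> z != y -> rho z < rho y)
          (touch rho x y).
Proof.
apply: (iffP allP) => H z.
  move=> Hz zy; have := H z; rewrite mem_iota (negbTE zy) /=; apply; lia.
rewrite mem_iota => Hz; case: eqP => //= /eqP zy; apply: H => //; lia.
Qed.

Definition upd (rho : nat -> nat) (t x y : nat) : nat :=
  if touch rho x y then t else rho y.

Fixpoint touch_cost (n : nat) (rho : nat -> nat) (t : nat) (X : seq nat) : nat :=
  match X with
  | [::] => 0
  | x :: X' => count (touch rho x) (iota 1 n) + touch_cost n (upd rho t x) t.+1 X'
  end.

Fixpoint touch_run (rho : nat -> nat) (t : nat) (X : seq nat) : nat -> nat :=
  match X with
  | [::] => rho
  | x :: X' => touch_run (upd rho t x) t.+1 X'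
  end.

Lemma touch_refl rho x : touch rho x x.
Proof. by apply/touchP => z; lia. Qed.

Lemma touch_blocked rho x y z :
  minn x y <= z <= maxn x y -> z != y -> rho y <= rho z -> touch rho x y = false.
Proof. by move=> Hz zy le; apply/negP => /touchP /(_ z Hz zy); lia. Qed.

Lemma upd_self rho t x : upd rho t x x = t.
Proof. by rewrite /upd touch_refl. Qed.

Lemma upd_bounded rho t x :
  (forall y, rho y < t) -> forall y, upd rho t x y < t.+1.
Proof. by move=> H y; rewrite /upd; case: ifP => // _; have := H y; lia. Qed.

(** * Search trees compatible with touch times *)

Definition first_query (fut : seq nat) (lo hi x : nat) : Prop :=
  has (fun y => lo < y < hi) fut /\
  nth 0 fut (find (fun y => lo < y < hi) fut) = x.

Lemma first_query_in fut lo hi x : first_query fut lo hi x -> lo < x < hi.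
Proof. by case=> H <-; apply: (nth_find 0 H). Qed.

Lemma first_query_cons x fut lo hi y :
  first_query (x :: fut) lo hi y <->
  if lo < x < hi then y = x else first_query fut lo hi y.
Proof.
rewrite /first_query /=; case: ifP => //= _; split; last by move=> ->.
by case.
Qed.

Lemma first_query_sub fut lo hi lo' hi' x :
  lo <= lo' -> hi' <= hi -> lo' < x < hi' ->
  first_query fut lo hi x -> first_query fut lo' hi' x.
Proof.
move=> h1 h2 hx; elim: fut => [[]//|y fut IH] /first_query_cons H; apply/first_query_cons.
case: ifP => Hy.
  move: H; rewrite ifT; last lia.
  by [].
by move: H; case: ifP => [_ E|_ /IH //]; lia.
Qed.

(* The bounds [lo < hi] of a subtree are its neighbouring keys, with [0] and
   [n.+1] as sentinels.  The last clause is what the treap order of GF ensures: the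
   next query entering a subtree touches the root of that subtree. *)
Fixpoint good (rho : nat -> nat) (fut : seq nat) (lo hi : nat) (T : bst) : Prop :=
  match T with
  | Leaf => hi = lo.+1
  | Node l k r =>
      [/\ good rho fut lo k l, good rho fut k hi r,
          forall y, lo < y < hi -> rho y <= rho k
        & forall x, first_query fut lo hi x -> touch rho x k]
  end.

Lemma good_lt rho fut T lo hi : good rho fut lo hi T -> lo < hi.
Proof.
elim: T lo hi => [|l IHl k r IHr] lo hi /=; first by move->.
by case=> /IHl h1 /IHr h2 _ _; lia.
Qed.

Lemma touch_ext rho rho' x k :
  (forall z, minn x k <= z <= maxn x k -> rho z = rho' z) ->
  touch rho x k = touch rho' x k.
Proof.
move=> E; apply/touchP/touchP => H z Hz zk; have := H z Hz zk;
rewrite !E //; lia.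
Qed.

(** Every clause of [good] looks only at keys and first queries inside the interval. The condition
    on futures goes one way, because [good] uses first queries only as hypotheses. *)
Lemma good_ext rho rho' fut fut' T lo hi :
  (forall y, lo < y < hi -> rho y = rho' y) ->
  (forall a b x, lo <= a -> b <= hi -> first_query fut' a b x -> first_query fut a b x) ->
  good rho fut lo hi T -> good rho' fut' lo hi T.
Proof.
move=> + + G; elim: T lo hi G => [|l IHl k r IHr] lo hi //= [Gl Gr H1 H2] E F.
have [kl kh] := (good_lt Gl, good_lt Gr).
split.
- by apply: IHl => // [y Hy|a b x *]; [apply: E; lia|apply: F => //; lia].
- by apply: IHr => // [y Hy|a b x *]; [apply: E; lia|apply: F => //; lia].
- by move=> y Hy; rewrite -!E ?H1 //; lia.
- move=> x Hx; have Hx2 := first_query_in Hx.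
  rewrite -(@touch_ext rho) => [|z Hz]; first by apply/H2/F.
  by apply: E; lia.
Qed.

Fixpoint height (T : bst) : nat :=
  if T is Node l _ r then (maxn (height l) (height r)).+1 else 0.

Fixpoint rank (T : bst) (y : nat) : nat :=
  if T is Node l k r then
    if y == k then height T else if y < k then rank l y else rank r y
  else 0.

Lemma rank_le T y : rank T y <= height T.
Proof. by elim: T => //= l IHl k r IHr; case: ifP => _ //; case: ifP; lia. Qed.

(** [rank] gives each key the height of the subtree rooted at it, so the root of a subtree strictly
    exceeds every other key of its interval and is touched by any query entering it. Hence the
    initial tree is good for every future. *)
Lemma good_rank fut T lo m :
  inorder T = iota lo.+1 m -> good (rank T) fut lo (lo + m).+1 T.
Proof.
elim: T lo m => [|l IHl k r IHr] lo m /=; first by case: m => //= _; rewrite addn0.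
move=> E.
have sm : m = size (inorder l) + (size (inorder r)).+1.
  by rewrite -(size_iota lo.+1 m) -E size_cat.
move: E; rewrite sm iotaD => /eqP; rewrite eqseq_cat ?size_iota //.
case/andP => /eqP /IHl Gl /=; rewrite eqseq_cons => /andP [/eqP Ek /eqP Er].
have {}Gr := IHr _ _ Er.
set T := Node l k r.
have rl y : y < k -> rank T y = rank l y.
  by move=> h; rewrite /T /= h; case: eqP => //; lia.
have rr y : k < y -> rank T y = rank r y.
  by move=> h; rewrite /T /=; case: eqP => //; [lia|case: ltnP => //; lia].
have rk : rank T k = height T by rewrite /T /= eqxx.
have lk y : y != k -> rank T y < rank T k.
  move=> ne; rewrite rk /T /= (negbTE ne); case: ifP => _.
    by have := rank_le l y; lia.
  by have := rank_le r y; lia.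
have ek : (lo + size (inorder l)).+1 = k by lia.
split.
- apply: good_ext (_ : good (rank l) fut lo k l) => [y Hy|//|]; last by rewrite -ek.
  by apply: esym; apply: rl; lia.
- apply: good_ext (_ : good (rank r) fut k _ r) => [y Hy|//|].
    by apply: esym; apply: rr; lia.
  by move: Gr; congr good; lia.
- move=> y _; change (rank T y <= rank T k).
  by have [->|/lk/ltnW] := eqVneq y k.
- by move=> x _; apply/touchP => z _ /lk.
Qed.

(** * The search path and the subtrees hanging off it *)

Fixpoint hung rho fut (lo hi : nat) (ks : seq nat) (rs : seq bst) : Prop :=
  match ks, rs with
  | [::], [:: R] => good rho fut lo hi R
  | k :: ks', R :: rs' => good rho fut lo k R /\ hung rho fut k hi ks' rs'
  | _, _ => False
  end.

Lemma hung_rcons rho fut lo k hi ks rs r :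
  hung rho fut lo k ks rs -> good rho fut k hi r ->
  hung rho fut lo hi (rcons ks k) (rcons rs r).
Proof.
elim: ks rs lo => [|k' ks IH] [|R rs] lo //=; first by case: rs.
by case=> ? H G; split=> //; apply: IH.
Qed.

Lemma hung_lt rho fut lo hi ks rs : hung rho fut lo hi ks rs -> lo < hi.
Proof.
elim: ks rs lo => [|k ks IH] [|R rs] lo //=.
  by case: rs => // /good_lt.
by case=> /good_lt + /IH; lia.
Qed.

Lemma hung_mem rho fut lo hi ks rs y :
  hung rho fut lo hi ks rs -> y \in ks -> lo < y < hi.
Proof.
elim: ks rs lo => [|k ks IH] [|R rs] lo //= [/good_lt G H].
rewrite inE => /orP [/eqP ->|/(IH _ _ H)]; have := hung_lt H; lia.
Qed.

Lemma hung_uniq rho fut lo hi ks rs : hung rho fut lo hi ks rs -> uniq ks.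
Proof.
elim: ks rs lo => [|k ks IH] [|R rs] lo //= [_ H]; rewrite (IH _ _ H) andbT.
by apply/negP => /(hung_mem H); lia.
Qed.

Lemma hung_ext rho rho' fut fut' lo hi ks rs :
  (forall y, lo < y < hi -> y \notin ks -> rho y = rho' y) ->
  (forall a b x, (forall y, a < y < b -> lo < y < hi /\ y \notin ks) ->
     first_query fut' a b x -> first_query fut a b x) ->
  hung rho fut lo hi ks rs -> hung rho' fut' lo hi ks rs.
Proof.
move=> + + H; elim: ks rs lo H => [|k ks IH] [|R rs] lo //= + E F.
  case: rs => // G; apply: good_ext G => [y Hy|a b x h1 h2]; first exact: E.
  by apply: F => y Hy; split=> //; lia.
case=> G H; have [lk kh] := (good_lt G, hung_lt H).
have N y : y <= k -> y \notin ks.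
  by move=> yk; apply/negP => /(hung_mem H); lia.
split.
  apply: good_ext G => [y Hy|a b x h1 h2].
    by apply: E; [lia|rewrite inE negb_or N ?andbT; lia].
  by apply: F => y Hy; split; [lia|rewrite inE negb_or N ?andbT; lia].
apply: (IH _ _ H) => [y Hy yk|a b x Q].
  by apply: E; [lia|rewrite inE negb_or yk andbT; lia].
apply: F => y /Q [h1 h2]; split; first lia.
by rewrite inE negb_or h2 andbT; lia.
Qed.

Lemma hung_cat rho fut lo hi a k b rs :
  hung rho fut lo hi (a ++ k :: b) rs ->
  hung rho fut lo k a (take (size a).+1 rs) /\
  hung rho fut k hi b (drop (size a).+1 rs).
Proof.
elim: a rs lo => [|k' a IH] [|R rs] lo //=.
  by rewrite take0 drop0.
by case=> G /IH [H1 H2].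
Qed.

(** At each node [k] of the path, [k] is touched by the last clause of [good], and the keys on the
    far side of [k] are blocked because [rho k] is maximal in the interval. On the near side the
    recursion applies, [x] being also the first query of the smaller interval. *)
Lemma decomp_hung rho fut lo hi T x d :
  good rho fut lo hi T -> first_query fut lo hi x ->
  let D := decomp T x d in
  hung rho fut lo hi (map fst D.1) D.2 /\
  forall y, lo < y < hi -> (y \in map fst D.1) = touch rho x y.
Proof.
elim: T lo hi d => [|l IHl k r IHr] lo hi d /=.
  by move=> -> /first_query_in; lia.
case=> Gl Gr H1 H2 Hx; have Hx' := first_query_in Hx.
have [kl kh] := (good_lt Gl, good_lt Gr).
case: eqP => [xk|/eqP xk].
  split=> //= y Hy; rewrite inE; case: eqP => [->|/eqP yk].
    by rewrite xk touch_refl.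
  by rewrite (@touch_blocked _ _ _ k) ?H1 //; lia.
case: ltnP => xk'.
  have Hl : first_query fut lo k x by apply: first_query_sub Hx; lia.
  have /= := IHl _ _ d.+1 Gl Hl; case: (decomp l x d.+1) => ps rs /= [I1 I2].
  rewrite map_rcons; split; first exact: hung_rcons.
  move=> y Hy; rewrite mem_rcons inE; case: (ltngtP y k) => yk /=.
  - by apply: I2; lia.
  - rewrite (@touch_blocked _ _ _ k) ?H1 //; try lia.
    by apply/negP => /(hung_mem I1); lia.
  - by rewrite yk H2.
have Hr : first_query fut k hi x by apply: first_query_sub Hx; lia.
have /= := IHr _ _ d.+1 Gr Hr; case: (decomp r x d.+1) => ps rs /= [I1 I2].
split=> // y Hy; rewrite inE; case: (ltngtP y k) => yk /=.
- rewrite (@touch_blocked _ _ _ k) ?H1 //; try lia.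
  by apply/negP => /(hung_mem I1); lia.
- by apply: I2; lia.
- by rewrite yk H2.
Qed.

Lemma decomp_size rho fut n T x d :
  good rho fut 0 n.+1 T -> first_query fut 0 n.+1 x ->
  size (decomp T x d).1 = count (touch rho x) (iota 1 n).
Proof.
move=> G Hx; have [H M] := decomp_hung d G Hx.
rewrite -(size_map fst) -size_filter; apply: perm_size.
apply: uniq_perm; [exact: hung_uniq H|by rewrite filter_uniq ?iota_uniq|].
move=> y; rewrite mem_filter mem_iota; case Hy: (0 < y < n.+1).
  by rewrite M // andbT.
by rewrite andbF; apply/negP => /(hung_mem H); lia.
Qed.

(** * The treap built from the path *)

Definition next_pos (fut : seq nat) (lo hi : nat) : option nat :=
  let j := find (fun y => lo < y < hi) fut in
  if j < size fut then Some j else None.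

Definition pos_le (a b : option nat) : bool :=
  match a, b with
  | _, None => true
  | None, Some _ => false
  | Some i, Some j => i <= j
  end.

Lemma pos_le_refl : reflexive pos_le.
Proof. by case=> //= i. Qed.

Lemma pos_le_trans : transitive pos_le.
Proof. by case=> [j|] [i|] [k|] //=; apply: leq_trans. Qed.

Lemma prio_lt_pos_le a b : prio_lt a b -> pos_le a.1 b.1.
Proof. by case: a b => [[i|] d] [[j|] d'] //=; rewrite /prio_lt /=; lia. Qed.

Lemma prio_nlt_pos_le a b : ~~ prio_lt a b -> pos_le b.1 a.1.
Proof. by case: a b => [[i|] d] [[j|] d'] //=; rewrite /prio_lt /=; lia. Qed.

Lemma minidx_lt s : s != [::] -> minidx s < size s.
Proof. by elim: s => //= x [//|y s] IH _; case: ifP => // _; apply: IH. Qed.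

Lemma minidx_pos_le v0 s j :
  j < size s -> pos_le (nth v0 s (minidx s)).2.1 (nth v0 s j).2.1.
Proof.
elim: s j => // x [|y s] IH j; first by case: j => //= _; apply: pos_le_refl.
have m : minidx (y :: s) < size (y :: s) by apply: minidx_lt.
rewrite [minidx _]/=  -/(minidx (y :: s)).
rewrite (set_nth_default v0 x m).
case: ifP => [/prio_lt_pos_le|/negbT/prio_nlt_pos_le] H; case: j => [|j] //= jn.
- exact: IH.
- exact: pos_le_refl.
- by apply: pos_le_trans H _; apply: IH.
Qed.

(* The priorities of a list of consecutive path keys are those computed by [tau], with
   [lo] and [hi] as the outer neighbours. *)
Definition coherent (fut : seq nat) (lo hi : nat)
    (vs : seq (nat * (option nat * nat))) : Prop :=
  forall v0 j, j < size vs ->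
    (nth v0 vs j).2.1 =
    next_pos fut (nth lo (lo :: map fst vs) j) (nth hi (map fst vs) j.+1).

Lemma next_pos_cons y fut lo hi :
  next_pos (y :: fut) lo hi = if lo < y < hi then Some 0 else omap S (next_pos fut lo hi).
Proof. by rewrite /next_pos /=; case: (lo < y < hi) => //; rewrite ltnS; case: ifP. Qed.

(** The smaller interval cannot be hit earlier than the larger one, so the comparison amounts to
    equality, which means that the first query of the larger interval already lands in the
    smaller. *)
Lemma next_pos_first fut lo hi a b x :
  lo <= a -> b <= hi -> first_query fut lo hi x ->
  pos_le (next_pos fut a b) (next_pos fut lo hi) = (a < x < b).
Proof.
move=> la bh; elim: fut => [[]//|y fut IH] /first_query_cons; rewrite !next_pos_cons.
case: (boolP (lo < y < hi)) => [_ ->|Hy /IH <-].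
  by case: ifP => //= _; case: next_pos.
rewrite ifN; last lia.
by case: (next_pos fut a b) => [?|]; case: (next_pos fut lo hi).
Qed.

(** The intervals between the two neighbours of a path key overlap, so together they cover the whole
    of [(lo, hi)], the path keys included. *)
Lemma hung_locate rho fut lo hi ks rs x :
  hung rho fut lo hi ks rs -> ks != [::] -> lo < x < hi ->
  exists2 j, j < size ks & nth lo (lo :: ks) j < x < nth hi ks j.+1.
Proof.
elim: ks rs lo => [|k [|k' ks] IH] [|R rs] lo //= [_ H] _ Hx; first by exists 0.
case: (ltnP x k') => xk'; first by exists 0; rewrite //=; lia.
case: rs H IH => //= R' rs [G H] /(_ (R' :: rs) k (conj G H) isT) IH.
have := good_lt G.
case: IH => [|j jn Hj kk']; first by have := good_lt G; lia.
exists j.+1 => //; move: Hj; case: j jn => //= j jn.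
by rewrite (@set_nth_default _ (k' :: ks) lo k j (ltnW jn)).
Qed.

Lemma hung_bounds rho fut lo hi ks rs j :
  hung rho fut lo hi ks rs -> j < size ks ->
  lo <= nth lo (lo :: ks) j /\ nth hi ks j.+1 <= hi.
Proof.
move=> H jn; split.
  by case: j jn => //= j jn; case/andP: (hung_mem H (mem_nth lo (ltnW jn))) => /ltnW.
case: (ltnP j.+1 (size ks)) => [jn'|/(nth_default hi) -> //].
by case/andP: (hung_mem H (mem_nth hi jn')) => _ /ltnW.
Qed.

Lemma hung_gap rho fut lo hi ks rs j :
  hung rho fut lo hi ks rs -> j < size ks ->
  nth lo (lo :: ks) j < nth 0 ks j < nth hi ks j.+1 /\
  forall y, y \in ks -> nth lo (lo :: ks) j < y < nth hi ks j.+1 -> y = nth 0 ks j.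
Proof.
elim: ks rs lo j => [|k ks IH] [|R rs] lo // j [/good_lt lk H] jn.
case: j jn => [_|j jn].
  case: ks {IH} H => [H|k' ks].
    have kh := @hung_lt rho fut k hi [::] rs H.
    by split=> /= [|y]; [rewrite lk|rewrite inE => /eqP].
  case: rs => [[]|R' rs [/good_lt kk' H]] /=; split=> [|y]; first by rewrite lk.
  by rewrite !inE => /or3P [/eqP//|/eqP ->|/(hung_mem H)]; lia.
have [I1 I2] := IH _ _ _ H jn; have [b _] := hung_bounds H jn.
have -> : nth lo (lo :: k :: ks) j.+1 = nth k (k :: ks) j.
  by apply: set_nth_default; apply: ltnW.
split=> // y; rewrite inE => /orP [/eqP -> {I1 I2}|yk Hy]; first lia.
exact: I2.
Qed.

(** The path keys are exactly the keys with the maximal time [t]. So a query touches the treap root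
    as soon as no other path key lies between them, and the choice of minimal [tau] guarantees this
    for the next query. *)
Lemma good_build rho fut t f vs rs lo hi :
  size vs <= f -> hung rho fut lo hi (map fst vs) rs -> coherent fut lo hi vs ->
  (forall y, rho y <= t) ->
  (forall y, lo < y < hi -> (y \in map fst vs) = (rho y == t)) ->
  good rho fut lo hi (build f vs rs).
Proof.
move=> + + + B; elim: f vs rs lo hi => [|f IH] vs rs lo hi.
  by case: vs => //= _; case: rs => [|R []].
move=> sf H C E; case: vs sf H C E => [|v vs] sf H C E.
  by case: rs H => [|R []].
set vs' := v :: vs in sf H C E *.
have mi : minidx vs' < size vs' by apply: minidx_lt.
have mt j : j < size vs' -> _ := @minidx_pos_le v vs' j.
set i := minidx vs' in mi mt.
set k := nth 0 (map fst vs') i.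
have -> : build f.+1 vs' rs =
  Node (build f (take i vs') (take i.+1 rs)) k
       (build f (drop i.+1 vs') (drop i.+1 rs)) by [].
clearbody i vs'.
have ks : map fst vs' = take i (map fst vs') ++ k :: drop i.+1 (map fst vs').
  by rewrite /k -drop_nth ?size_map // cat_take_drop.
have st : size (take i (map fst vs')) = i by rewrite size_takel // size_map ltnW.
have H0 := H; move: H; rewrite ks => /hung_cat.
rewrite st -map_take -map_drop => -[Hl Hr].
have [kl kh] := (hung_lt Hl, hung_lt Hr).
have Ek : rho k = t.
  apply/eqP; rewrite -E; last lia.
  by rewrite mem_nth // size_map.
have memE y : y \in map fst vs' =
    [|| y \in map fst (take i vs'), y == k | y \in map fst (drop i.+1 vs')].
  by rewrite ks mem_cat inE map_take map_drop.
split.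
- apply: IH => //; first by rewrite size_takel ?(ltnW mi) //; lia.
  + move=> v0 j; rewrite size_takel ?(ltnW mi) // => ji.
    rewrite nth_take // C ?(ltn_trans ji) // map_take; congr next_pos.
      by case: j ji => //= j ji; rewrite nth_take //; lia.
    case: (ltnP j.+1 i) => ji'.
      by rewrite nth_take //; apply: set_nth_default; rewrite size_map; lia.
    (* The last key of the left part has the new root as its right neighbour: in the full list this
       is entry [i], in the truncated list the default [k]. *)
    rewrite [RHS]nth_default ?st // (_ : j.+1 = i); last lia.
    by apply: set_nth_default; rewrite size_map.
  + move=> y Hy; rewrite -E; last lia.
    rewrite memE.
    case: eqP => [|_]; first lia.
    case: (boolP (y \in map fst (drop _ _))) => [/(hung_mem Hr)|_]; first lia.
    by rewrite !orbF.
- apply: IH => //; first by rewrite size_drop; lia.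
  + move=> v0 j; rewrite size_drop => ji.
    rewrite nth_drop C; last lia.
    rewrite map_drop addSn [nth lo _ _]/= nth_drop addSn addnS; congr next_pos.
    case: j ji => [|j] ji /=; last first.
      by rewrite nth_drop addSnnS; apply: set_nth_default; rewrite size_map; lia.
    by rewrite addn0; apply: set_nth_default; rewrite size_map.
  + move=> y Hy; rewrite -E; last lia.
    rewrite memE.
    case: eqP => [|_]; first lia.
    case: (boolP (y \in map fst (take _ _))) => [/(hung_mem Hl)|_]; first lia.
    by [].
- by move=> y _; rewrite Ek.
- move=> x Hx; have Hx' := first_query_in Hx.
  have mi' : i < size (map fst vs') by rewrite size_map.
  (* The next query lies in the interval of some path key [j], whose position is then the earliest
     possible. The root [i] has a position at most that of [j], so its interval contains the query
     too. *)
  have Hm : nth lo (lo :: map fst vs') i < x < nth hi (map fst vs') i.+1.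
    have [|j] := hung_locate H0 _ Hx'.
      by rewrite -size_eq0 -lt0n; apply: leq_ltn_trans mi'.
    rewrite size_map => jn Hj.
    have [a1 b1] := hung_bounds H0 mi'.
    have jn' : j < size (map fst vs') by rewrite size_map.
    have [a2 b2] := hung_bounds H0 jn'.
    rewrite -(next_pos_first a2 b2 Hx) in Hj; rewrite -(next_pos_first a1 b1 Hx).
    by apply: pos_le_trans Hj; move: (mt j jn); rewrite !C.
  have [Hk U] := hung_gap H0 mi'; have [b1 b2] := hung_bounds H0 mi'.
  apply/touchP => z Hz zk.
  rewrite Ek ltn_neqAle B andbT -E; last lia.
  by apply/negP => /U Uz; move/eqP: zk; apply; apply: Uz; lia.
Qed.

Lemma good_gf_step n rho t x fut T :
  good rho (x :: fut) 0 n.+1 T -> 0 < x < n.+1 ->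
  all (in_keys n) fut -> (forall y, rho y < t) ->
  good (upd rho t x) fut 0 n.+1 (gf_step T x fut).
Proof.
move=> G Hx Hf B.
have Nx : first_query (x :: fut) 0 n.+1 x by apply/first_query_cons; rewrite Hx.
have := decomp_hung 0 G Nx; rewrite /gf_step.
case: (decomp T x 0) => ps rs /= [H M].
have Mx : x \in map fst ps by rewrite M // touch_refl.
set pr := [seq (tau _ _ i, _) | i <- iota _ _].
have spr : size pr = size ps by rewrite size_map size_iota.
have Ek : map fst (zip (map fst ps) pr) = map fst ps.
  by apply: unzip1_zip; rewrite size_map spr.
have sz : size (zip (map fst ps) pr) = size ps by rewrite size_zip size_map spr minnn.
apply: (@good_build _ _ t); rewrite ?sz ?Ek //.
- apply: hung_ext H => [y Hy yk|a b y Hab].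
    by rewrite /upd -M // (negbTE yk).
  (* The query [x] is itself a path key, so it lies in no gap, and dropping it from the future
     changes no first query there. *)
  rewrite first_query_cons ifN //; apply/negP => /Hab []; by rewrite Mx.
- move=> v0 j; rewrite sz Ek => jn.
  rewrite (surjective_pairing v0) nth_zip ?size_map ?size_iota //.
  rewrite (nth_map 0) ?size_iota // nth_iota // add0n /=.
  rewrite /tau /next_in /next_pos.
  set p := in_gap _ _; set q := (fun y => _).
  suff -> : find p fut = find q fut by [].
  (* All queries lie between [1] and [n], so the sentinels [0] and [n.+1] impose the same conditions
     as absent bounds. *)
  apply: eq_in_find => y /(allP Hf) Hy; rewrite /p /q /in_gap {p q}.
  congr andb.
    case: j jn => [|j] jn /=; first by move: Hy; rewrite /in_keys; lia.
    by congr (_ < _); apply: set_nth_default; rewrite size_map; lia.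
  rewrite size_map; case: ltnP => jn'.
    by congr (_ < _); apply: set_nth_default; rewrite size_map.
  by rewrite nth_default ?size_map //; move: Hy; rewrite /in_keys; lia.
- by move=> y; have := upd_bounded x B y; rewrite ltnS.
- move=> y Hy; rewrite M // /upd; case: touch; first by rewrite eqxx.
  by have := B y; case: eqP => //; lia.
Qed.

Lemma gf_cost_touch n rho t X T :
  good rho X 0 n.+1 T -> all (in_keys n) X -> (forall y, rho y < t) ->
  gf_cost T X = touch_cost n rho t X.
Proof.
elim: X rho t T => //= x X IH rho t T G /andP [Hx HX] B.
have Hx' : 0 < x < n.+1 by move: Hx; rewrite /in_keys; lia.
rewrite /search_path (decomp_size 0 G); last by apply/first_query_cons; rewrite Hx'.
congr addn; apply: IH => //; first exact: good_gf_step.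
exact: upd_bounded.
Qed.

Lemma gf_cost_touch_rank n T X :
  is_bst_on n T -> all (in_keys n) X ->
  gf_cost T X = touch_cost n (rank T) (height T).+1 X.
Proof.
move=> /eqP H HX; apply: gf_cost_touch => // [|y]; first exact: good_rank H.
by rewrite ltnS rank_le.
Qed.

(** * The periodic query sequence and its cheap regime *)

(* A block of depth [d.+1] at offset [o] is laid out as: left block, [a], [c], [b],
   right block, where [c = o + bsize d + 1]. *)
Fixpoint bsize (d : nat) : nat := if d is d'.+1 then (bsize d').*2 + 3 else 1.

(** Each sub-block receives its own queries in order. Among the first [i] queries to the block,
    [i.+1 %/ 3] go to the right block and [i %/ 3] to the left one. *)
Fixpoint query (d o i : nat) : nat :=
  if d is d'.+1 then
    if i %% 3 == 0 then o + bsize d' + 1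
    else if i %% 3 == 1 then query d' (o + bsize d' + 3) (i %/ 3)
    else query d' o (i %/ 3)
  else o.

(* The keys that occur as queries: the leaves and the centres [c]. *)
Fixpoint active (d o y : nat) : bool :=
  if d is d'.+1 then
    [|| y == o + bsize d' + 1, active d' o y | active d' (o + bsize d' + 3) y]
  else y == o.

Lemma bsize_gt0 d : 0 < bsize d.
Proof. by case: d => //= d; lia. Qed.

Lemma active_range d o y : active d o y -> o <= y < o + bsize d.
Proof.
elim: d o => [|d IH] o /=; first by move=> /eqP ->; lia.
by case/or3P => [/eqP ->|/IH|/IH]; lia.
Qed.

Lemma query_active d o i : active d o (query d o i).
Proof.
elim: d o i => [|d IH] o i //=.
by case: ifP => _; last case: ifP => _; rewrite ?eqxx ?IH ?orbT.
Qed.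

(* State of the active keys after [i] queries to the block when [a] and [b] play
   no role. *)
Fixpoint low (rho : nat -> nat) (d o i : nat) : Prop :=
  if d is d'.+1 then
    let c := o + bsize d' + 1 in
    [/\ forall y, active d'.+1 o y -> rho y <= rho c,
        i %% 3 = 1 -> forall y, active d' (o + bsize d' + 3) y -> rho y < rho c,
        i %% 3 = 2 -> forall y, active d' o y -> rho y < rho c,
        low rho d' (o + bsize d' + 3) (i.+1 %/ 3)
      & low rho d' o (i %/ 3)]
  else True.

(** The path to the query in the static tree whose inner nodes are the centres. *)
Fixpoint lpath (d o i : nat) : seq nat :=
  if d is d'.+1 then
    let c := o + bsize d' + 1 in
    if i %% 3 == 0 then [:: c]
    else if i %% 3 == 1 then c :: lpath d' (o + bsize d' + 3) (i %/ 3)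
    else c :: lpath d' o (i %/ 3)
  else [:: o].

Lemma low_ext rho rho' d o i :
  (forall y, active d o y -> rho y = rho' y) -> low rho d o i -> low rho' d o i.
Proof.
elim: d o i => [|d IH] o i //= E [H1 H2 H3 H4 H5].
have Ec : rho' (o + bsize d + 1) = rho (o + bsize d + 1) by rewrite E ?eqxx.
split.
- by move=> y Hy; rewrite Ec -E //; apply: H1.
- by move=> /H2 H y Hy; rewrite Ec -E ?H ?Hy ?orbT.
- by move=> /H3 H y Hy; rewrite Ec -E ?H ?Hy ?orbT.
- by apply: IH H4 => y Hy; apply: E; rewrite Hy !orbT.
- by apply: IH H5 => y Hy; apply: E; rewrite Hy !orbT.
Qed.

(** The threshold [m] separates inactive keys from active ones. The centre is a newest active key,
    so it shields each sub-block from queries to the other and, when queried itself, shields both.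
    Every query to a sub-block touches it, which keeps it newest. *)
Lemma low_step m rho t d o i :
  (forall y, rho y < t) ->
  (forall y, o <= y < o + bsize d -> ~~ active d o y -> rho y <= m) ->
  (forall y, active d o y -> m <= rho y) ->
  low rho d o i ->
  low (upd rho t (query d o i)) d o i.+1 /\
  forall y, active d o y -> touch rho (query d o i) y -> y \in lpath d o i.
Proof.
move=> B; elim: d o i => [|d IH] o i J M.
  by move=> _; split=> //= y /eqP ->; rewrite inE.
set c := o + bsize d + 1; set oR := o + bsize d + 3.
move=> [H1 H2 H3 H4 H5].
have B' x y : upd rho t x y <= t by rewrite -ltnS upd_bounded.
have rc : active d.+1 o c by rewrite /= eqxx.
have rL y : active d o y -> active d.+1 o y by move=> /= ->; rewrite !orbT.
have rR y : active d oR y -> active d.+1 o y by move=> /= ->; rewrite !orbT.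
have blk x y : minn x y <= c <= maxn x y -> c != y -> active d.+1 o y ->
    touch rho x y = false.
  by move=> h1 h2 /H1; apply: touch_blocked.
have JL y : o <= y < o + bsize d -> ~~ active d o y -> rho y <= m.
  move=> Hy nr; apply: J; rewrite /= ?(negbTE nr); first by lia.
  by apply/negP => /orP [/eqP|/active_range]; lia.
have JR y : oR <= y < oR + bsize d -> ~~ active d oR y -> rho y <= m.
  move=> Hy nr; apply: J; rewrite /= ?(negbTE nr) ?orbF; first by lia.
  by apply/negP => /orP [/eqP|/active_range]; lia.
rewrite [query _ _ _]/= [lpath _ _ _]/= -/c -/oR.
case: eqP => [i0|n0].
  have nt y : active d.+1 o y -> y != c -> touch rho c y = false.
    by move=> Hy yc; apply: blk => //; [lia|rewrite eq_sym].
  have nL y : active d o y -> upd rho t c y = rho y.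
    by move=> Hy; rewrite /upd nt ?rL //; have := active_range Hy; lia.
  have nR y : active d oR y -> upd rho t c y = rho y.
    by move=> Hy; rewrite /upd nt ?rR //; have := active_range Hy; lia.
  split; last first.
    by move=> y Hy; apply: contraLR; rewrite inE => yc; rewrite nt.
  split; rewrite -/c -/oR ?upd_self //; try lia.
  - by move=> _ y /nR ->.
  - have -> : i.+2 %/ 3 = i.+1 %/ 3 by lia.
    by apply: low_ext H4 => y /nR.
  - have -> : i.+1 %/ 3 = i %/ 3 by lia.
    by apply: low_ext H5 => y /nL.
case: eqP => [i1|n1].
  set x := query d oR _.
  have xr : active d oR x by apply: query_active.
  have xb := active_range xr.
  have [|R1 R2] := IH oR (i %/ 3) JR (fun y h => M y (rR y h)).
    by have <- : i.+1 %/ 3 = i %/ 3 by lia.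
  (* Active keys on the way to [c] are strictly older than [c]; inactive ones are at most [m], hence
     at most [rho x], which is below [rho c]. *)
  have tc : touch rho x c.
    apply/touchP => z Hz zc; case: (boolP (active d oR z)) => [/(H2 i1)//|nr].
    apply: leq_ltn_trans (H2 i1 _ xr); apply: leq_trans (M _ (rR _ xr)).
    case: (ltnP z oR) => zo; last by apply: JR => //; lia.
    apply: J => /=; first by lia.
    rewrite (negbTE nr) orbF; apply/negP => /orP [/eqP|/active_range]; lia.
  have ec : upd rho t x c = t by rewrite /upd tc.
  have nL y : active d o y -> touch rho x y = false.
    by move=> Hy; have Hy' := active_range Hy; apply: blk; [lia|lia|apply: rL].
  split; last first.
    move=> y /or3P [/eqP ->|Hy|Hy] ty; rewrite inE ?eqxx //.
      by rewrite nL in ty.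
    by rewrite R2 ?orbT.
  split; rewrite -/c -/oR ?ec //; try lia.
  - by move=> _ y Hy; rewrite /upd nL.
  - by have -> : i.+2 %/ 3 = (i %/ 3).+1 by lia.
  - have -> : i.+1 %/ 3 = i %/ 3 by lia.
    by apply: low_ext H5 => y /nL; rewrite /upd => ->.
have i2 : i %% 3 = 2 by lia.
set x := query d o _.
have xr : active d o x by apply: query_active.
have xb := active_range xr.
have [|R1 R2] := IH o (i %/ 3) JL (fun y h => M y (rL y h)) => //.
have tc : touch rho x c.
  apply/touchP => z Hz zc; case: (boolP (active d o z)) => [/(H3 i2)//|nr].
  apply: leq_ltn_trans (H3 i2 _ xr); apply: leq_trans (M _ (rL _ xr)).
  case: (ltnP z (o + bsize d)) => zo; first by apply: JL => //; lia.
  apply: J => /=; first by lia.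
  rewrite (negbTE nr) /=; apply/negP => /orP [/eqP|/active_range]; lia.
have ec : upd rho t x c = t by rewrite /upd tc.
have nR y : active d oR y -> touch rho x y = false.
  by move=> Hy; have Hy' := active_range Hy; apply: blk; [lia|lia|apply: rR].
split; last first.
  move=> y /or3P [/eqP ->|Hy|Hy] ty; rewrite inE ?eqxx //.
    by rewrite R2 ?orbT.
  by rewrite nR in ty.
split; rewrite -/c -/oR ?ec //; try lia.
- have -> : i.+2 %/ 3 = i.+1 %/ 3 by lia.
  by apply: low_ext H4 => y /nR; rewrite /upd => ->.
- by have -> : i.+1 %/ 3 = (i %/ 3).+1 by lia.
Qed.

(** * The expensive regime *)

(* State of a whole block after [i] queries when [a] and [b] replace the centre. *)
Fixpoint high (rho : nat -> nat) (d o i : nat) : Prop :=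
  if d is d'.+1 then
    let a := o + bsize d' in let c := a.+1 in let b := a.+2 in
    [/\ [/\ forall y, o <= y < a -> rho y <= rho a
          & forall y, b < y <= b + bsize d' -> rho y <= rho b],
        i %% 3 = 0 -> rho c < rho a /\ rho c < rho b,
        i %% 3 <> 0 ->
          [/\ rho c <= rho a, rho a <= rho b & forall y, o <= y < a -> rho y < rho a],
        i %% 3 = 1 -> forall y, b < y <= b + bsize d' -> rho y < rho b
      & [/\ i %% 3 = 2 -> rho a < rho b,
            high rho d' (o + bsize d' + 3) (i.+1 %/ 3) & high rho d' o (i %/ 3)]]
  else True.

Fixpoint hpath (d o i : nat) : seq nat :=
  if d is d'.+1 then
    let a := o + bsize d' in
    if i %% 3 == 0 then [:: a; a.+1; a.+2]
    else if i %% 3 == 1 then a.+2 :: hpath d' (o + bsize d' + 3) (i %/ 3)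
    else [:: a, a.+2 & hpath d' o (i %/ 3)]
  else [:: o].

Lemma query_range d o i : o <= query d o i < o + bsize d.
Proof. exact/active_range/query_active. Qed.

Lemma high_ext rho rho' d o i :
  (forall y, o <= y < o + bsize d -> rho y = rho' y) ->
  high rho d o i -> high rho' d o i.
Proof.
elim: d o i => [|d IH] o i //= E [[H1 H2] H3 H4 H5 [H6 H7 H8]].
have Ea : rho' (o + bsize d) = rho (o + bsize d) by rewrite E //; lia.
have Ec : rho' (o + bsize d).+1 = rho (o + bsize d).+1 by rewrite E //; lia.
have Eb : rho' (o + bsize d).+2 = rho (o + bsize d).+2 by rewrite E //; lia.
rewrite Ea Ec Eb; split=> //.
- by split=> y Hy; rewrite -E ?H1 ?H2 //; lia.
- move=> /H4 [h1 h2 h3]; split=> // y Hy; rewrite -E ?h3 //; lia.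
- by move=> /H5 h y Hy; rewrite -E ?h //; lia.
split=> //.
- by apply: IH H7 => y Hy; apply: E; lia.
- by apply: IH H8 => y Hy; apply: E; lia.
Qed.

Lemma hpath_range d o i y : y \in hpath d o i -> o <= y < o + bsize d.
Proof.
elim: d o i => [|d IH] o i /=; first by rewrite inE => /eqP ->; lia.
case: ifP => _; last case: ifP => _; rewrite !inE.
- by case/or3P => /eqP ->; lia.
- by case/orP => [/eqP ->|/IH]; lia.
- by case/or3P => [/eqP ->|/eqP ->|/IH]; lia.
Qed.

Lemma hpath_uniq d o i : uniq (hpath d o i).
Proof.
elim: d o i => [|d IH] o i //=.
case: ifP => _; first by rewrite /= !inE; lia.
case: ifP => _ /=; rewrite ?inE IH andbT.
  by apply/negP => /hpath_range; lia.
rewrite negb_or; apply/andP; split; last by apply/negP => /hpath_range; lia.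
by apply/andP; split; [lia|apply/negP => /hpath_range; lia].
Qed.

(** A query to [c] touches the newer keys [a] and [b], leaving all three tied. A query to the right
    block touches [b], which blocks [a] and becomes strictly newer. A query to the left block then
    touches both [a] and [b], while [a] blocks [c], so [c] is again strictly older and the cycle
    restarts. *)
Lemma high_step rho t d o i :
  (forall y, rho y < t) ->
  high rho d o i ->
  high (upd rho t (query d o i)) d o i.+1 /\
  forall y, y \in hpath d o i -> touch rho (query d o i) y.
Proof.
move=> B; elim: d o i => [|d IH] o i.
  by move=> _; split=> //= y; rewrite inE => /eqP ->; apply: touch_refl.
have B' x y : upd rho t x y <= t by rewrite -ltnS upd_bounded.
set a := o + bsize d; set c := a.+1; set b := a.+2; set oR := o + bsize d + 3.
have ec : o + bsize d + 1 = c by lia.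
have eb : b.+1 = oR by lia.
rewrite [query _ _ _]/= [hpath _ _ _]/= ec -/a -/oR -/c -/b.
move=> [[H1 H2] H3 H4 H5 [H6 H7 H8]].
rewrite -/a -/c -/b -/oR in H1 H2 H3 H4 H5 H6 H7 H8.
case: eqP => [i0|n0].
  have [ca cb] := H3 i0.
  have ta : touch rho c a by apply/touchP => z *; have -> : z = c by lia.
  have tb : touch rho c b by apply/touchP => z *; have -> : z = c by lia.
  have nL y : o <= y < a -> touch rho c y = false.
    by move=> Hy; apply: (@touch_blocked _ _ _ a); [lia|lia|apply: H1].
  have nR y : b < y <= b + bsize d -> touch rho c y = false.
    by move=> Hy; apply: (@touch_blocked _ _ _ b); [lia|lia|apply: H2].
  have ua : upd rho t c a = t by rewrite /upd ta.
  have ub : upd rho t c b = t by rewrite /upd tb.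
  split; last first.
    by move=> y; rewrite !inE => /or3P [] /eqP ->; rewrite ?touch_refl.
  split; rewrite -/a -/c -/b -/oR ?ua ?ub ?upd_self; try lia.
  - by split=> y _; apply: B'.
  - by move=> _; split=> // y Hy; rewrite /upd nL.
  - by move=> _ y Hy; rewrite /upd nR.
  split; try lia.
  - have -> : i.+2 %/ 3 = i.+1 %/ 3 by lia.
    by apply: high_ext H7 => y Hy; rewrite /upd nR //; lia.
  - have -> : i.+1 %/ 3 = i %/ 3 by lia.
    by apply: high_ext H8 => y Hy; rewrite /upd nL //; lia.
have [ca ab La] := H4 n0.
case: eqP => [i1|n1].
  have Rb := H5 i1; set x := query d oR _.
  have xb : oR <= x < oR + bsize d by apply: query_range.
  have [|R1 R2] := IH oR (i %/ 3).
    by have <- : i.+1 %/ 3 = i %/ 3 by lia.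
  have tb : touch rho x b by apply/touchP => z *; apply: Rb; lia.
  have nb y : y < b -> rho y <= rho b -> touch rho x y = false.
    by move=> *; apply: (@touch_blocked _ _ _ b); lia.
  have nL y : o <= y < a -> touch rho x y = false.
    by move=> Hy; apply: nb; [lia|have := La _ Hy; lia].
  have na : touch rho x a = false by apply: nb; lia.
  have nc : touch rho x c = false by apply: nb; lia.
  have ua : upd rho t x a = rho a by rewrite /upd na.
  have uc : upd rho t x c = rho c by rewrite /upd nc.
  have ub : upd rho t x b = t by rewrite /upd tb.
  split; last by move=> y; rewrite inE => /orP [/eqP -> //|/R2].
  split; rewrite -/a -/c -/b -/oR ?ua ?ub ?uc; try lia.
  - by split=> y Hy; [rewrite /upd nL ?H1|apply: B'].
  - by move=> _; split=> // [|y Hy]; [apply/ltnW|rewrite /upd nL ?La].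
  split; first by [].
  - by have -> : i.+2 %/ 3 = (i %/ 3).+1 by lia.
  - have -> : i.+1 %/ 3 = i %/ 3 by lia.
    by apply: high_ext H8 => y Hy; rewrite /upd nL.
have i2 : i %% 3 = 2 by lia.
have {H6}ab' := H6 i2; set x := query d o _.
have xb : o <= x < o + bsize d by apply: query_range.
have [|R1 R2] := IH o (i %/ 3) => //.
have ta : touch rho x a by apply/touchP => z *; apply: La; lia.
have tb : touch rho x b.
  apply/touchP => z Hz zb; case: (ltngtP z a) => [za|az|-> //].
    by have := La z; lia.
  have -> : z = c by lia.
  exact: leq_ltn_trans ca ab'.
have nc : touch rho x c = false by apply: (@touch_blocked _ _ _ a); lia.
have nR y : b < y <= b + bsize d -> touch rho x y = false.
  by move=> Hy; apply: (@touch_blocked _ _ _ b); [lia|lia|apply: H2].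
have ua : upd rho t x a = t by rewrite /upd ta.
have ub : upd rho t x b = t by rewrite /upd tb.
have uc : upd rho t x c = rho c by rewrite /upd nc.
split; last by move=> y; rewrite !inE => /or3P [/eqP -> //|/eqP -> //|/R2].
split; rewrite -/a -/c -/b -/oR ?ua ?ub ?uc; try lia.
- by split=> y _; apply: B'.
- by move=> _; split; apply: B.
split; try lia.
- have -> : i.+2 %/ 3 = i.+1 %/ 3 by lia.
  by apply: high_ext H7 => y Hy; rewrite /upd nR //; lia.
- by have -> : i.+1 %/ 3 = (i %/ 3).+1 by lia.
Qed.

(** * Cost sums over complete rounds *)

Fixpoint lcost (d i : nat) : nat :=
  if d is d'.+1 then if i %% 3 == 0 then 1 else (lcost d' (i %/ 3)).+1 else 1.

Fixpoint hcost (d i : nat) : nat :=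
  if d is d'.+1 then
    if i %% 3 == 0 then 3 else
    if i %% 3 == 1 then (hcost d' (i %/ 3)).+1 else (hcost d' (i %/ 3)).+2
  else 1.

Lemma size_lpath d o i : size (lpath d o i) = lcost d i.
Proof.
elim: d o i => [|d IH] o i //=.
by case: ifP => _ //; case: ifP => _ /=; rewrite IH.
Qed.

Lemma size_hpath d o i : size (hpath d o i) = hcost d i.
Proof.
elim: d o i => [|d IH] o i //=.
by case: ifP => _ //; case: ifP => _ /=; rewrite IH.
Qed.

(** In round [j] both sub-blocks receive their query number [j], at equal cost [G j]; [a] is what
    the top level adds per round. *)
Lemma sum_thirds (F G : nat -> nat) a k :
  (forall j, F (3 * j) + F (3 * j).+1 + F (3 * j).+2 = a + (G j).*2) ->
  \sum_(0 <= i < 3 * k) F i = a * k + (\sum_(0 <= j < k) G j).*2.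
Proof.
move=> E; elim: k => [|k IH]; first by rewrite !muln0 !big_geq.
have -> : 3 * k.+1 = (3 * k).+3 by lia.
by rewrite !big_nat_recr //= IH; have := E k; lia.
Qed.

Lemma sum_lcost_ge d m : m <= \sum_(0 <= i < m) lcost d i.
Proof.
rewrite -[X in X <= _](subn0 m) -[X in X <= _]muln1 -sum_nat_const_nat.
by apply: leq_sum => i _; case: d => //= d; case: ifP.
Qed.

(* [2 ^ d * m] counts the queries to leaves, where both regimes cost 1. *)
Lemma sum_hcost d m :
  \sum_(0 <= i < 3 ^ d * m) hcost d i + 2 ^ d * m =
  (\sum_(0 <= i < 3 ^ d * m) lcost d i).*2.
Proof.
elim: d m => [|d IH] m; first by rewrite !mul1n /= !sum_nat_const_nat; lia.
(* The top level adds [6 = 3 + 1 + 2] per round in the expensive regime and, further down,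
   [3 = 1 + 1 + 1] in the cheap one. *)
rewrite !expnS -!mulnA (@sum_thirds _ (hcost d) 6) => [|j]; last first.
  rewrite /=; have [-> -> ->] : [/\ (3 * j) %% 3 = 0, (3 * j).+1 %% 3 = 1 & (3 * j).+2 %% 3 = 2].
    by split; lia.
  have [-> ->] : (3 * j).+1 %/ 3 = j /\ (3 * j).+2 %/ 3 = j by split; lia.
  by rewrite /=; lia.
rewrite (@sum_thirds _ (lcost d) 3) => [|j]; last first.
  rewrite /=; have [-> -> ->] : [/\ (3 * j) %% 3 = 0, (3 * j).+1 %% 3 = 1 & (3 * j).+2 %% 3 = 2].
    by split; lia.
  have [-> ->] : (3 * j).+1 %/ 3 = j /\ (3 * j).+2 %/ 3 = j by split; lia.
  by rewrite /=; lia.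
by have := IH m; lia.
Qed.

(** * Reaching the two regimes *)

Lemma touch_cost_cat n rho t X Y :
  touch_cost n rho t (X ++ Y) =
  touch_cost n rho t X + touch_cost n (touch_run rho t X) (t + size X) Y.
Proof.
elim: X rho t => [|x X IH] rho t /=; first by rewrite addn0.
by rewrite IH addnA addnS.
Qed.

Lemma touch_run_cat rho t X Y :
  touch_run rho t (X ++ Y) = touch_run (touch_run rho t X) (t + size X) Y.
Proof. by elim: X rho t => [|x X IH] rho t /=; rewrite ?addn0 // IH addnS. Qed.

Lemma touch_run_rcons rho t X x :
  touch_run rho t (rcons X x) = upd (touch_run rho t X) (t + size X) x.
Proof. by rewrite -cats1 touch_run_cat. Qed.

Lemma touch_run_bounded rho t X :
  (forall y, rho y < t) -> forall y, touch_run rho t X y < t + size X.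
Proof.
elim: X rho t => [|x X IH] rho t B /=; first by rewrite addn0.
by rewrite addnS -addSn; apply: IH; apply: upd_bounded.
Qed.

Lemma touch_cost_le n rho t X : touch_cost n rho t X <= n * size X.
Proof.
elim: X rho t => //= x X IH rho t; rewrite mulnS leq_add //.
by rewrite -[X in _ <= X](size_iota 1) count_size.
Qed.

Lemma touch_cost_low n m rho t d o i k :
  (forall y, rho y < t) ->
  (forall y, ~~ active d o y -> rho y <= m) ->
  (forall y, active d o y -> m <= rho y) ->
  low rho d o i ->
  touch_cost n rho t (map (query d o) (iota i k)) <= \sum_(i <= j < i + k) lcost d j.
Proof.
elim: k i rho t => [|k IH] i rho t B J M L //=.
have [L' P] := low_step B (fun y _ => J y) M L.
(* An inactive key is blocked by the queried key itself, so the threshold [m] persists throughout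
   the run. *)
have nt y : ~~ active d o y -> touch rho (query d o i) y = false.
  move=> ny; have xr := query_active d o i.
  apply: (@touch_blocked _ _ _ (query d o i)); first by lia.
    by apply: contraNneq ny => <-.
  exact: leq_trans (J _ ny) (M _ xr).
rewrite big_ltn; last by rewrite addnS ltnS leq_addr.
apply: leq_add.
  rewrite -(size_lpath d o) -size_filter; apply: uniq_leq_size.
    by rewrite filter_uniq ?iota_uniq.
  move=> y; rewrite mem_filter => /andP [ty _]; apply: P (ty).
  by apply: contraLR ty => /nt ->.
rewrite -addSnnS; apply: IH => //; first exact: upd_bounded.
  by move=> y ny; rewrite /upd nt ?J.
move=> y ry; rewrite /upd; case: ifP => _; last exact: M.
by apply: leq_trans (M _ ry) _; apply/ltnW.
Qed.

Lemma touch_cost_high n rho t d o i k :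
  0 < o -> o + bsize d <= n.+1 -> (forall y, rho y < t) -> high rho d o i ->
  \sum_(i <= j < i + k) hcost d j <= touch_cost n rho t (map (query d o) (iota i k)).
Proof.
move=> o0 on; elim: k i rho t => [|k IH] i rho t B H /=.
  by rewrite addn0 big_geq.
have [H' P] := high_step B H.
rewrite big_ltn; last by rewrite addnS ltnS leq_addr.
apply: leq_add.
  rewrite -(size_hpath d o) -size_filter; apply: uniq_leq_size.
    exact: hpath_uniq.
  move=> y Hy; rewrite mem_filter P // mem_iota.
  by have := hpath_range Hy; lia.
by rewrite -addSnnS; apply: IH => //; apply: upd_bounded.
Qed.

(** * Runs that equalise touch times or single out a set of keys *)

Lemma upd_ge rho t x y : (forall z, rho z < t) -> rho y <= upd rho t x y.
Proof. by move=> B; rewrite /upd; case: ifP => // _; apply: ltnW. Qed.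

(** The key queried last is a newest one and shields all smaller keys from the next query. Only that
    key can change, and its time can only grow. *)
Lemma run_ascending rho t n :
  (forall y, rho y < t) ->
  forall y z, 0 < y -> y <= z <= n ->
  touch_run rho t (iota 1 n) y <= touch_run rho t (iota 1 n) z.
Proof.
move=> B.
suff: (0 < n -> forall y, touch_run rho t (iota 1 n) y <= touch_run rho t (iota 1 n) n) /\
    forall y z, 0 < y -> y <= z <= n ->
    touch_run rho t (iota 1 n) y <= touch_run rho t (iota 1 n) z by case.
elim: n => [|n [I1 I2]]; first by split=> // y z; lia.
have En : iota 1 n.+1 = rcons (iota 1 n) n.+1 by rewrite -cats1 -(iotaD 1 n 1) addn1.
have B' := touch_run_bounded (iota 1 n) B.
rewrite En touch_run_rcons size_iota in B' *.
set s := touch_run _ _ _ in I1 I2 B' *.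
have un y : upd s (t + n) n.+1 y <= upd s (t + n) n.+1 n.+1.
  by rewrite upd_self -ltnS upd_bounded.
split=> // y z y0 /andP [yz]; rewrite leq_eqVlt => /orP [/eqP -> //|zn].
have nt u : u < n -> upd s (t + n) n.+1 u = s u.
  move=> h; rewrite /upd (@touch_blocked _ _ _ n) //; try lia.
  by apply: I1; lia.
move: yz; rewrite leq_eqVlt => /orP [/eqP -> //|yz].
rewrite nt; last by lia.
apply: leq_trans (upd_ge _ _ B'); apply: I2 => //; lia.
Qed.

(** Among the keys up to [n], each query below [n] touches only itself and its right neighbour:
    smaller keys are blocked by the initial order, larger ones by that neighbour, which is newest.
    So key [y > 1] ends with the time of the query to [y - 1], and [1] ties with [2]. *)
Lemma run_descending rho t n :
  (forall y, rho y < t) ->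
  (forall y z, 0 < y -> y <= z <= n -> rho y <= rho z) ->
  forall y z, 1 < y -> y < z <= n ->
  touch_run rho t (rev (iota 1 n)) z < touch_run rho t (rev (iota 1 n)) y.
Proof.
move=> B A.
suff I k : k <= n -> let s := touch_run rho t (rev (iota (n - k).+1 k)) in
    [/\ forall y, 0 < y <= n - k -> s y = rho y,
        forall y z, (n - k).+1 < y -> y < z <= n -> s z < s y
      & 0 < k -> t <= s (n - k).+1 /\ forall y, s y <= s (n - k).+1].
  by have [] := I n (leqnn n); rewrite subnn.
elim: k => [|k IH] kn /=; first by split=> // y z; lia.
have [I1 I2 I3] := IH (ltnW kn).
have Ek : (n - k.+1).+1 = n - k by lia.
rewrite Ek rev_cons touch_run_rcons size_rev size_iota.
have B' := touch_run_bounded (rev (iota (n - k).+1 k)) B.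
rewrite size_rev size_iota in B'.
set s := touch_run _ _ _ in I1 I2 I3 B' *.
have ul y : 0 < y < n - k -> upd s (t + k) (n - k) y = rho y.
  move=> Hy; rewrite /upd (@touch_blocked _ _ _ (n - k)) ?I1 //; try lia.
  by apply: A; lia.
have ur y : (n - k).+1 < y -> y <= n -> upd s (t + k) (n - k) y = s y.
  move=> y1 y2; have k0 : 0 < k by lia.
  have [_ h] := I3 k0.
  by rewrite /upd (@touch_blocked _ _ _ (n - k).+1) //; lia.
split.
- by move=> y Hy; apply: ul; lia.
- move=> y z y1 /andP [yz zn]; rewrite (ur z) //; last by lia.
  move: y1; rewrite leq_eqVlt => /orP [/eqP y1|y1]; last first.
    by rewrite ur ?I2 //; lia.
  have {y1} ? := esym y1; subst y.
  rewrite /upd ifT //; apply/touchP => u Hu u1.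
  have -> : u = n - k by lia.
  rewrite I1; last by lia.
  have k0 : 0 < k by lia.
  by have [h _] := I3 k0; apply: leq_trans (B _) h.
- move=> _; rewrite upd_self leq_addr; split=> // y.
  by rewrite -ltnS upd_bounded.
Qed.

(* The ascending pass sorts the touch times, and the descending one reverses the order
   with strict decrease beyond key [1]; then [n] touches all keys but possibly [1]. *)
Definition flattening (n : nat) : seq nat := iota 1 n ++ rev (iota 1 n) ++ [:: n].

(** The value [t + (n + n)] is the time of the closing query to [n], after two passes of [n] queries
    each. *)
Lemma run_flattening rho t n y :
  (forall z, rho z < t) -> 1 < y <= n ->
  touch_run rho t (flattening n) y = t + (n + n).
Proof.
move=> B Hy; rewrite /flattening !touch_run_cat size_rev size_iota /= addnA /upd.
rewrite ifT //; apply/touchP => z Hz zy.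
have B1 := touch_run_bounded (iota 1 n) B; rewrite size_iota in B1.
by apply: run_descending => //; try lia; apply: run_ascending.
Qed.

Lemma sorted_rcons (J : seq nat) j :
  sorted ltn (rcons J j) -> sorted ltn J /\ {in J, forall y, y < j}.
Proof.
rewrite !(sorted_pairwise ltn_trans) pairwise_rcons => /andP [/allP H ->].
by split=> // y /H.
Qed.

(** Each query touches only itself and its predecessor in [J]: keys outside [J] are blocked by the
    queried key, still at the old maximum [s], and earlier keys of [J] by that predecessor. The last
    two keys of [J] therefore tie, whence the strict bound on [z]. *)
Lemma run_sorted rho s t J :
  (forall y, rho y <= s) -> s < t -> sorted ltn J ->
  (forall y, y \in J -> rho y = s) ->
  let rho' := touch_run rho t J in
  [/\ forall y, y \notin J -> rho' y = rho y,
      forall y, y \in J -> s < rho' y <= rho' (last 0 J)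
    & forall y z, y \in J -> z \in J -> y < z < last 0 J -> rho' y < rho' z].
Proof.
move=> R st; elim/last_ind: J => [|J j IH] //= /sorted_rcons [SJ Jj] E.
have EJ y : y \in J -> rho y = s by move=> yJ; apply: E; rewrite mem_rcons inE yJ orbT.
have [I1 I2 I3] := IH SJ EJ.
have B : forall y, touch_run rho t J y < t + size J.
  by apply: touch_run_bounded => y; apply: leq_ltn_trans st.
rewrite touch_run_rcons last_rcons; set r := touch_run _ _ _ in I1 I2 I3 B *.
have jJ : j \notin J by apply/negP => /Jj; rewrite ltnn.
have rj : r j = s by rewrite I1 // E // mem_rcons inE eqxx.
have nt y : y \notin J -> y != j -> upd r (t + size J) j y = rho y.
  move=> /I1 ry yj; rewrite /upd (@touch_blocked _ _ _ j) ?ry ?rj ?R //.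
    by lia.
  by rewrite eq_sym.
have ge y : r y <= upd r (t + size J) j y by apply: upd_ge.
have le y : upd r (t + size J) j y <= upd r (t + size J) j j.
  by rewrite upd_self -ltnS upd_bounded.
have lJ y : y \in J -> y <= last 0 J /\ last 0 J \in J.
  case/lastP: (J) SJ => // J' l /sorted_rcons [_ H].
  by rewrite last_rcons !mem_rcons !inE eqxx => /orP [/eqP ->|/H /ltnW].
have ntJ y : y \in J -> y < last 0 J -> upd r (t + size J) j y = r y.
  move=> yJ yl; have [_ /Jj lj] := lJ _ yJ; have /andP [_ h] := I2 y yJ.
  by rewrite /upd (@touch_blocked _ _ _ (last 0 J)) //; lia.
split.
- by move=> y; rewrite mem_rcons inE negb_or => /andP [yj yJ]; apply: nt.
- move=> y; rewrite mem_rcons inE le andbT => /orP [/eqP ->|yJ].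
    by rewrite upd_self; lia.
  by apply: leq_trans (ge y); case/andP: (I2 y yJ).
- move=> y z; rewrite !mem_rcons !inE => Hy Hz /andP [yz zj].
  have {Hz} zJ : z \in J by case/orP: Hz => // /eqP; lia.
  have {Hy} yJ : y \in J by case/orP: Hy => // /eqP; lia.
  have [zl lJ'] := lJ _ zJ.
  rewrite (ntJ y) //; last by lia.
  move: zl; rewrite leq_eqVlt => /orP [/eqP zl|zl].
    rewrite [X in _ < X]/upd ifT //; apply/touchP => u Hu uz.
    have uJ : u \notin J by apply/negP => /lJ []; lia.
    by rewrite I1 //; apply: leq_ltn_trans (R u) _; case/andP: (I2 z zJ).
  by rewrite ntJ // I3 //; lia.
Qed.

(** After the pass over [J] the times increase along [J], so one query from the left touches every
    key of [J] before the last. All other keys are blocked at the level [s]. This makes a prescribed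
    set of keys the newest. *)
Lemma run_flat_sub rho s t x J :
  (forall y, rho y <= s) -> s < t -> sorted ltn J ->
  (forall y, y \in x :: J -> rho y = s) -> {in J, forall y, x < y} ->
  let rho' := touch_run rho t (rcons J x) in
  (forall y, y \in J -> y < last 0 J -> rho' y = t + size J) /\
  forall y, y \notin J -> y != x -> rho' y <= s.
Proof.
move=> R st SJ E xJ /=; rewrite touch_run_rcons.
have EJ y : y \in J -> rho y = s by move=> yJ; apply: E; rewrite inE yJ orbT.
have [I1 I2 I3] := run_sorted R st SJ EJ.
set r := touch_run _ _ _ in I1 I2 I3 *.
have next_pos : x \notin J by apply/negP => /xJ; rewrite ltnn.
split=> [y yJ yl|y yJ yx].
  rewrite /upd ifT //; apply/touchP => z Hz zy; have := xJ _ yJ => xy.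
  case: (boolP (z \in J)) => [zJ|/I1 ->]; first by apply: I3 => //; lia.
  by apply: leq_ltn_trans (R z) _; case/andP: (I2 y yJ).
have ex : rho x = s by rewrite E // inE eqxx.
rewrite /upd (@touch_blocked _ _ _ x) ?I1 ?ex ?R //; first by lia.
by rewrite eq_sym.
Qed.

(** The exempt key [o] is the leftmost leaf, which the setup queries last. At index [0] strict
    inequalities are required only for centres, and [o] is never one. *)
Lemma high_init rho T d o :
  (forall y, rho y <= T) ->
  (forall y, o <= y < o + bsize d -> ~~ active d o y -> rho y = T) ->
  (forall y, active d o y -> y != o -> rho y < T) -> high rho d o 0.
Proof.
move=> R; elim: d o => [|d IH] o //= J M.
have nr y : (o + bsize d == y) || (y == (o + bsize d).+2) -> rho y = T.
  move=> Hy; apply: J; first by lia.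
  by apply/negP => /or3P [/eqP|/active_range|/active_range]; lia.
rewrite !(nr (o + bsize d)) ?(nr (o + bsize d).+2) ?eqxx ?orbT //.
split=> //.
- have b := bsize_gt0 d; have Hc : rho (o + bsize d).+1 < T.
    by apply: M; [rewrite addn1 eqxx|lia].
  by move=> _.
split=> //; apply: IH.
- move=> y Hy ny; apply: J; first by lia.
  rewrite (negbTE ny) orbF; apply/negP => /orP [/eqP|/active_range]; lia.
- move=> y ry yo; apply: M; first by rewrite ry !orbT.
  by have := active_range ry; lia.
- move=> y Hy ny; apply: J; first by lia.
  rewrite (negbTE ny) /=; apply/negP => /orP [/eqP|/active_range]; lia.
- by move=> y ry yo; apply: M => //; rewrite ry !orbT.
Qed.

Lemma low_init rho T d o :
  (forall y, rho y <= T) -> (forall y, active d o y -> rho y = T) -> low rho d o 0.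
Proof.
move=> R; elim: d o => [|d IH] o //= M.
split=> //; first by move=> y _; rewrite (M (o + bsize d + 1)) ?eqxx.
  by apply: IH => y ry; apply: M; rewrite ry !orbT.
by apply: IH => y ry; apply: M; rewrite ry !orbT.
Qed.

(** * Comparing the two runs *)

(** The block starts at [2] because flattening does not control key [1]. The range runs one key past
    the block, and this extra last key absorbs the exception in [run_flat_sub]. *)
Definition junk (d : nat) : seq nat :=
  [seq y <- iota 2 (bsize d).+1 | ~~ active d 2 y].

(** The length is a multiple of [3 ^ d], so that every level completes whole rounds. *)
Definition rounds (d m : nat) : seq nat := map (query d 2) (iota 0 (3 ^ d * m)).

Definition setup (d n : nat) : seq nat := flattening n ++ rcons (junk d) 2.

Lemma junkP d y : (y \in junk d) = (2 <= y < 2 + (bsize d).+1) && ~~ active d 2 y.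
Proof. by rewrite mem_filter mem_iota andbC. Qed.

Lemma last_junk d : last 0 (junk d) = 2 + bsize d.
Proof.
rewrite /junk -[(bsize d).+1]addn1 iotaD filter_cat last_cat /= ifT //.
by apply/negP => /active_range; lia.
Qed.

Lemma active_left d o : active d o o.
Proof. by elim: d o => [|d IH] o /=; rewrite ?eqxx ?IH ?orbT. Qed.

Lemma flattening_flat rho t n :
  (forall y, rho y < t) -> let rho' := touch_run rho t (flattening n) in
  (forall y, rho' y <= t + (n + n)) /\
  forall y, 1 < y <= n -> rho' y = t + (n + n).
Proof.
move=> B; split=> y; last exact: run_flattening.
have := touch_run_bounded (flattening n) B y.
by rewrite !size_cat size_rev size_iota /=; lia.
Qed.

Lemma size_flattening n : size (flattening n) = (n + n).+1.
Proof. by rewrite !size_cat size_rev size_iota /=; lia. Qed.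

(** Flattening erases the history: [rho] is arbitrary, so the bound also applies after the expensive
    setup. *)
Lemma rounds_low n rho t d m :
  bsize d + 2 <= n -> (forall y, rho y < t) ->
  touch_cost n rho t (flattening n ++ rounds d m) <=
  n * size (flattening n) + \sum_(0 <= i < 3 ^ d * m) lcost d i.
Proof.
move=> dn B; rewrite touch_cost_cat leq_add ?touch_cost_le //.
have [R E] := flattening_flat n B.
have Er y : active d 2 y -> touch_run rho t (flattening n) y = t + (n + n).
  by move=> /active_range ?; apply: E; lia.
(* The threshold is the common time of the active keys, which is also the global maximum. *)
apply: (@touch_cost_low _ (t + (n + n))) => [|y _|y /Er ->|] //.
  by apply: touch_run_bounded.
exact: low_init R Er.
Qed.

Lemma rounds_high n rho t d m :
  bsize d + 2 <= n -> (forall y, rho y < t) ->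
  \sum_(0 <= i < 3 ^ d * m) hcost d i <= touch_cost n rho t (setup d n ++ rounds d m).
Proof.
move=> dn B; rewrite touch_cost_cat; apply: leq_trans (leq_addl _ _).
have B' := touch_run_bounded (setup d n) B.
apply: touch_cost_high => //; first by lia.
have [R E] := flattening_flat n B.
set s := t + (n + n) in R E.
have st : s < t + size (flattening n) by rewrite size_flattening; lia.
have SJ : sorted ltn (junk d).
  by apply: sorted_filter (iota_ltn_sorted _ _); apply: ltn_trans.
have nJ : 2 \notin junk d by rewrite junkP active_left andbF.
have xJ : {in junk d, forall y, 2 < y}.
  move=> y yJ; rewrite ltn_neqAle; apply/andP; split.
    by apply: contraNneq nJ => ->.
  by move: yJ; rewrite junkP => /andP [/andP []].
have [|H1 H2] := run_flat_sub R st SJ _ xJ.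
  by move=> y; rewrite inE junkP => Hy; apply: E; case/orP: Hy => [/eqP ->|]; lia.
rewrite /setup touch_run_cat size_cat size_rcons addnA addnS in B' *.
set r := touch_run _ _ _ in H1 H2 B' *.
apply: high_init.
- by move=> y; rewrite -ltnS; apply: B'.
- by move=> y Hy ny; apply: H1; rewrite ?last_junk ?junkP ?ny; lia.
- move=> y ry y2; apply: leq_ltn_trans (H2 y _ y2) _; last by lia.
  by rewrite junkP ry andbF.
Qed.

Lemma rounds_keys n d m : bsize d + 2 <= n -> all (in_keys n) (rounds d m).
Proof.
move=> dn; apply/allP => y /mapP [i _ ->].
by have := query_range d 2 i; rewrite /in_keys; lia.
Qed.

Lemma flattening_keys n : 0 < n -> all (in_keys n) (flattening n).
Proof.
move=> n0; apply/allP => y; rewrite !mem_cat mem_rev mem_iota inE /in_keys; lia.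
Qed.

Lemma setup_keys n d : bsize d + 2 <= n -> all (in_keys n) (setup d n).
Proof.
move=> dn; rewrite all_cat flattening_keys; last by lia.
apply/allP => y; rewrite mem_rcons inE junkP /in_keys; lia.
Qed.

(** * Choice of the depth and final estimate *)

Lemma bernoulli d : d.+2 * 2 ^ d <= 2 * 3 ^ d.
Proof. by elim: d => [|d IH] //; rewrite !expnS; nia. Qed.

(** This makes the share [(2/3)^d] of leaf queries at most [eps / 2]. The lemma [bernoulli] is the
    inequality [(3/2)^d >= 1 + d/2] with denominators cleared. *)
Lemma depth_exists (eps : R) : (0 < eps)%R ->
  exists d, (2 * INR (2 ^ d)%N <= eps * INR (3 ^ d)%N)%R.
Proof.
move=> e0; have [d Hd] := INR_archimed eps 4 e0; exists d.
have := le_INR _ _ (leP (bernoulli d)); rewrite !mult_INR !S_INR.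
move: (INR (2 ^ d)%N) (INR (3 ^ d)%N) (INR d) Hd (pos_INR (2 ^ d)%N) (pos_INR d).
move=> u v w Hd u0 w0 H.
have h1 : (eps * (w * u) <= eps * (2 * v))%R.
  by apply: Rmult_le_compat_l; simpl in H; nra.
have h2 : (4 * u <= w * eps * u)%R by apply: Rmult_le_compat_r; lra.
nra.
Qed.

(** The tree is arbitrary, but [n] must be large enough for a block whose depth is determined by
    [eps]. Nonemptiness of [X] rules out the trivial case of two zero costs. *)
Theorem theorem3 :
  forall eps : R, (0 < eps)%R ->
  exists N : nat, forall (n : nat) (T0 : bst),
    N <= n -> is_bst_on n T0 ->
    exists X X' : seq nat,
      [/\ X != [::], all (in_keys n) X, subseq X' X &
          ((2 - eps) * INR (gf_cost T0 X) <= INR (gf_cost T0 X'))%R].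
Proof.
move=> eps e0; have [d Hd] := depth_exists e0.
(* Room for key [1], the block, and the extra key after it. *)
exists (bsize d + 2) => n T dn HT.
(* [C] bounds the cost of both preparatory phases in [X]. The number [m] of rounds is chosen so that
   [2 * C] is at most the number [2 ^ d * m] of leaf queries. *)
set C := n * size (setup d n) + n * size (flattening n).
set m := C.*2.
exists (setup d n ++ flattening n ++ rounds d m), (setup d n ++ rounds d m).
have [kS kF kR] : [/\ all (in_keys n) (setup d n), all (in_keys n) (flattening n)
    & all (in_keys n) (rounds d m)].
  by rewrite setup_keys ?flattening_keys ?rounds_keys //; lia.
split.
- by rewrite -size_eq0 !size_cat /=; lia.
- by rewrite all_cat kS all_cat kF.
- by rewrite subseq_cat2l suffix_subseq.
have B y : rank T y < (height T).+1 by rewrite ltnS rank_le.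
rewrite !(gf_cost_touch_rank HT); try by rewrite all_cat kS // all_cat kF.
set cX := touch_cost n _ _ (_ ++ _ ++ _); set cX' := touch_cost n _ _ _.
set L := \sum_(0 <= i < 3 ^ d * m) lcost d i.
have HX : cX <= C + L.
  rewrite /cX touch_cost_cat -addnA leq_add ?touch_cost_le //.
  by apply: rounds_low => //; apply: touch_run_bounded.
have HX' : L.*2 <= cX' + 2 ^ d * m.
  by rewrite -sum_hcost leq_add2r; apply: rounds_high.
have HL : 3 ^ d * m <= L by apply: sum_lcost_ge.
have Hm : C.*2 <= 2 ^ d * m by rewrite -[X in X <= _]mul1n leq_mul2r expn_gt0 orbT.
move: (leP HX) (leP HX') (leP HL) (leP Hm) => {HX HX' HL Hm}.
rewrite -!muln2; clearbody cX cX' L m C => /le_INR + /le_INR + /le_INR + /le_INR.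
rewrite !plus_INR !mult_INR.
have := pos_INR cX; have := pos_INR cX'; have := pos_INR C; have := pos_INR m.
move: (INR cX) (INR cX') (INR C) (INR L) (INR m) Hd => x x' c l k.
move: (INR (2 ^ d)%N) (INR (3 ^ d)%N) => u v Hd k0 c0 x'0 x0 /= h1 h2 h3 h4.
(* The gain [eps * l] covers [2 * u * k]: one [u * k] pays for the leaf queries, which do not get
   dearer, the other for the overhead [2 * c]. *)
have h5 : (2 * u * k <= eps * v * k)%R by apply: Rmult_le_compat_r.
have h6 : (eps * (v * k) <= eps * l)%R by apply: Rmult_le_compat_l; lra.
case: (Rle_lt_dec eps 2) => e2; last first.
  have : (0 <= (eps - 2) * x)%R by apply: Rmult_le_pos; lra.
  lra.
have h7 : ((2 - eps) * x <= (2 - eps) * (c + l))%R by apply: Rmult_le_compat_l; lra.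
have h8 : (0 <= eps * c)%R by apply: Rmult_le_pos; lra.
lra.
Qed.
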